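(* Let $x,y:I\to\mathbb{R}$ be smooth functions on an open interval $I$ with $(x'(s))^2-(y'(s))^2=1$ and $\varepsilon_1\,(y(s)^2-x(s)^2)>0$ for all $s\in I$, where $\varepsilon_1\in\{1,-1\}$ is fixed. Let $M_2$ be the rotation surface in $\mathbb{E}_2^4$ given by $$\varphi(t,s)=\bigl(x(s)\cos t,\;x(s)\sin t,\;y(s)\cos t,\;y(s)\sin t\bigr),$$ and suppose that $M_2$ is flat. Then $M_2$ has pointwise 1-type Gauss map if and only if $M_2$ is either totally geodesic or parametrized by $$\varphi(t,s)=\left(\begin{array}{c} \frac12\varepsilon\left(\mu_2e^{(-b_0s+d)}+\mu_1e^{-(-b_0s+d)}\right)\cos t,\\ \frac12\varepsilon\left(\mu_2e^{(-b_0s+d)}+\mu_1e^{-(-b_0s+d)}\right)\sin t,\\ \frac12\varepsilon\left(\mu_2e^{(-b_0s+d)}-\mu_1e^{-(-b_0s+d)}\right)\cos t,\\ \frac12\varepsilon\left(\mu_2e^{(-b_0s+d)}-\mu_1e^{-(-b_0s+d)}\right)\sin t \end{array}\right),\qquad \mu_1\mu_2=-\frac{1}{b_0^2},$$ for some real constants $b_0\neq 0$, $\mu_1$, $\mu_2$, $d$ and some $\varepsilon\in\{1,-1\}$.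
   Context: $\mathbb{E}_2^4$ is $\mathbb{R}^4$ with the pseudo-Euclidean metric $g=dx_1^2+dx_2^2-dx_3^2-dx_4^2$. The surface is parametrized by $(t,s)\in\mathbb{R}\times I$ (as an immersion) and carries the induced (non-degenerate) metric. It is flat if its Gaussian curvature vanishes identically, and totally geodesic if its second fundamental form vanishes identically. Gauss map: $\wedge^2\mathbb{E}_2^4$ is given the indefinite inner product $\langle u_1\wedge u_2,v_1\wedge v_2\rangle=\det(\langle u_i,v_j\rangle)$. The Gauss map is $G=e_1\wedge e_2:M\to\wedge^2\mathbb{E}_2^4$, where $e_1=\varphi_t/\sqrt{\varepsilon_1(y^2-x^2)}$ and $e_2=\varphi_s$ form an orthonormal tangent frame. Laplacian: for a smooth function $F$ on the surface, real-valued or with values in $\wedge^2\mathbb{E}_2^4$ (a fixed vector space, so $\Delta$ acts componentwise), $\Delta F=-\sum_i\epsilon_i\bigl(e_ie_iF-(\nabla_{e_i}e_i)F\bigr)$, where $\{e_i\}$ is a local orthonormal tangent frame, $\epsilon_i=\langle e_i,e_i\rangle=\pm1$, and $\nabla$ is the Levi-Civita connection of the induced metric. The surface has pointwise 1-type Gauss map if $\Delta G=f\,(G+C)$ for some smooth real function $f$ on the surface and some constant vector $C\in\wedge^2\mathbb{E}_2^4$. *)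

(* Defs.v *)
From Stdlib Require Import Reals.
From Coquelicot Require Import Coquelicot.

Open Scope R_scope.

(** ** The ambient space and its bivectors *)

Inductive axis : Set := X1 | X2 | X3 | X4.

Definition E42 : Type := axis -> R.

Definition vec4 (c1 c2 c3 c4 : R) : E42 :=
  fun a => match a with X1 => c1 | X2 => c2 | X3 => c3 | X4 => c4 end.

Definition inner (u v : E42) : R :=
  u X1 * v X1 + u X2 * v X2 - u X3 * v X3 - u X4 * v X4.

(** A bivector is given by its six coordinates in the basis [e_i /\ e_j],
    [i < j], of the second exterior power. *)
Inductive plane : Set := P12 | P13 | P14 | P23 | P24 | P34.

Definition bivector : Type := plane -> R.

Definition plane_axes (p : plane) : axis * axis :=
  match p with
  | P12 => (X1, X2) | P13 => (X1, X3) | P14 => (X1, X4)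
  | P23 => (X2, X3) | P24 => (X2, X4) | P34 => (X3, X4)
  end.

Definition wedge (u v : E42) : bivector :=
  fun p => let (i, j) := plane_axes p in u i * v j - u j * v i.

(** ** Calculus on the parameter domain *)

Inductive coord : Set := ct | cs.

Definition csum (F : coord -> R) : R := F ct + F cs.

(** Functions of the parameters [(t, s)]; all operators below are local, so
    only their values on the open domain under consideration matter. *)
Definition scalar_field : Type := R -> R -> R.

Definition partial (i : coord) (F : scalar_field) : scalar_field :=
  match i with
  | ct => fun t s => Derive (fun u => F u s) t
  | cs => fun t s => Derive (fun v => F t v) s
  end.

(** Tangent vector fields, by their components along d/dt and d/ds. *)
Definition vector_field : Type := coord -> scalar_field.

Definition coord_field (i : coord) : vector_field :=
  fun k _ _ =>
    match i, k with ct, ct => 1 | cs, cs => 1 | _, _ => 0 end.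

Definition act (X : vector_field) (F : scalar_field) : scalar_field :=
  fun t s => csum (fun i => X i t s * partial i F t s).

Definition in_interval (a b : Rbar) (s : R) : Prop :=
  Rbar_lt a s /\ Rbar_lt s b.

Definition smooth_on (a b : Rbar) (h : R -> R) : Prop :=
  forall s, in_interval a b s -> forall n, ex_derive_n h n s.

Definition smooth2_on (a b : Rbar) (F : scalar_field) : Prop :=
  forall t s, in_interval a b s -> forall n, ex_diff_n F n t s.

(** ** Geometry of a parametrized surface *)

Definition surface : Type := R -> R -> E42.

Definition component (phi : surface) (c : axis) : scalar_field :=
  fun t s => phi t s c.

Definition push (phi : surface) (X : vector_field) (t s : R) : E42 :=
  fun c => act X (component phi c) t s.

Definition metric (phi : surface) (i j : coord) : scalar_field :=
  fun t s => inner (push phi (coord_field i) t s) (push phi (coord_field j) t s).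

Definition metric_det (phi : surface) : scalar_field :=
  fun t s =>
    metric phi ct ct t s * metric phi cs cs t s
    - metric phi ct cs t s * metric phi cs ct t s.

Definition metric_inv (phi : surface) (i j : coord) : scalar_field :=
  fun t s =>
    match i, j with
    | ct, ct => metric phi cs cs t s / metric_det phi t s
    | cs, cs => metric phi ct ct t s / metric_det phi t s
    | _, _ => - metric phi i j t s / metric_det phi t s
    end.

Definition metric_prod (phi : surface) (X Y : vector_field) : scalar_field :=
  fun t s =>
    csum (fun i => csum (fun j => metric phi i j t s * X i t s * Y j t s)).

Definition christoffel (phi : surface) (k i j : coord) : scalar_field :=
  fun t s =>
    / 2 * csum (fun l =>
      metric_inv phi k l t s *
      (partial i (metric phi j l) t s + partial j (metric phi i l) t s
       - partial l (metric phi i j) t s)).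

(** Levi-Civita connection of the induced metric. *)
Definition nabla (phi : surface) (X Y : vector_field) : vector_field :=
  fun k t s =>
    act X (Y k) t s
    + csum (fun i => csum (fun j =>
        christoffel phi k i j t s * X i t s * Y j t s)).

(** [<R(d_t, d_s) d_s, d_t> / (<d_t,d_t> <d_s,d_s> - <d_t,d_s>^2)]; the
    bracket term of [R] is absent because coordinate fields commute. *)
Definition gauss_curvature (phi : surface) : scalar_field :=
  let dt := coord_field ct in
  let ds := coord_field cs in
  let Rds : vector_field := fun k t s =>
    nabla phi dt (nabla phi ds ds) k t s
    - nabla phi ds (nabla phi dt ds) k t s in
  fun t s => metric_prod phi Rds dt t s / metric_det phi t s.

(** Gauss formula: the ambient derivative of [Y] along [X] minus its
    tangential part [nabla_X Y]. *)
Definition second_fundamental_form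
    (phi : surface) (X Y : vector_field) : surface :=
  fun t s c =>
    act X (act Y (component phi c)) t s
    - act (nabla phi X Y) (component phi c) t s.

Definition flat (a b : Rbar) (phi : surface) : Prop :=
  forall t s, in_interval a b s -> gauss_curvature phi t s = 0.

Definition totally_geodesic (a b : Rbar) (phi : surface) : Prop :=
  forall t s, in_interval a b s -> forall (i j : coord) (c : axis),
    second_fundamental_form phi (coord_field i) (coord_field j) t s c = 0.

(** Here [e1, e2] is meant to be an orthonormal tangent frame. *)
Definition laplacian (phi : surface) (e1 e2 : vector_field)
    (F : scalar_field) : scalar_field :=
  fun t s =>
    - (metric_prod phi e1 e1 t s *
         (act e1 (act e1 F) t s - act (nabla phi e1 e1) F t s)
       + metric_prod phi e2 e2 t s *
         (act e2 (act e2 F) t s - act (nabla phi e2 e2) F t s)).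

Definition gauss_map (phi : surface) (e1 e2 : vector_field)
    (t s : R) : bivector :=
  wedge (push phi e1 t s) (push phi e2 t s).

Definition pointwise_1_type (a b : Rbar) (phi : surface)
    (e1 e2 : vector_field) : Prop :=
  exists (f : scalar_field) (C : bivector),
    smooth2_on a b f /\
    forall t s, in_interval a b s -> forall p : plane,
      laplacian phi e1 e2 (fun u v => gauss_map phi e1 e2 u v p) t s
      = f t s * (gauss_map phi e1 e2 t s p + C p).

(** ** The rotation surface *)

Definition rotation_surface (x y : R -> R) : surface :=
  fun t s => vec4 (x s * cos t) (x s * sin t) (y s * cos t) (y s * sin t).

(** The adapted frame [e_1 = phi_t / sqrt (eps1 (y^2 - x^2))], [e_2 = phi_s]. *)
Definition frame1 (eps1 : R) (x y : R -> R) : vector_field :=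
  fun k t s =>
    coord_field ct k t s / sqrt (eps1 * (y s ^ 2 - x s ^ 2)).

Definition frame2 : vector_field := coord_field cs.

(* Main.v *)
Require Import Defs.
From Stdlib Require Import Reals Lra FunctionalExtensionality.
From Coquelicot Require Import Coquelicot.
Open Scope R_scope.

(** Write [q = sqrt (eps1 (y^2 - x^2))], so that the induced metric is
    [- eps1 q^2 dt^2 + ds^2] and its Gaussian curvature is [- q'' / q].
    Flatness therefore means [q' = alpha] for a constant [alpha].  The identity
    [(x x' - y y')^2 - (x' y - x y')^2 = (x^2 - y^2) (x'^2 - y'^2)] then turns
    [x' y - x y' = c q] into a second constant, with [c^2 = alpha^2 + eps1],
    and the profile curve solves the linear system
    [q x' = alpha x + eps1 c y], [q y' = alpha y + eps1 c x]
    ([flat_profile_of_flat]).  Everything is read off the pair [(alpha, c)].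

    The second fundamental form is [c] times a field that never vanishes
    ([second_fundamental_form_flat]), so the surface is totally geodesic exactly
    when [c = 0].  Each coordinate of the Gauss map is a combination of [1],
    [cos 2t], [sin 2t] and two functions [C(s)], [S(s)] with
    [C' = (2 eps1 c / q) S], [S' = (2 eps1 c / q) C], [C^2 - S^2 = - eps1]
    ([gauss_map_flat]).  The Laplacian kills the constants, multiplies the
    trigonometric part by [- 4 eps1 / q^2] and the part in [C, S] by
    [- 4 c^2 / q^2] ([laplacian_mode]).

    When [c <> 0], the trigonometric coordinates force [f = - 4 eps1 / q^2]
    along a line [t = const] in [Delta G = f (G + const)], and the coordinates
    in [C, S] then make [(c^2 - eps1) C = alpha^2 C] and [alpha^2 S] constant.
    Since [C] and [S] cannot both be constant, [alpha = 0]
    ([flat_slope_zero_of_pointwise_1_type]).  Conversely both [c = 0], where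
    [Delta G = 0], and [alpha = 0], where [c^2 = eps1] and both eigenvalues agree,
    give a pointwise 1-type Gauss map.  Finally [alpha = 0] means that
    [x^2 - y^2] is constant, and the linear system integrates to
    [x + y] and [x - y] being proportional to [exp (c s / q)] and
    [exp (- c s / q)], which is the announced parametrization. *)

(** * Calculus on the interval and on the strip *)

Lemma in_interval_locally (a b : Rbar) (s : R) :
  in_interval a b s -> locally s (in_interval a b).
Proof.
  intros hs.
  apply (open_and _ _ (open_Rbar_gt a) (open_Rbar_lt b)); exact hs.
Qed.

Lemma in_interval_convex (a b : Rbar) (s1 s2 s : R) :
  in_interval a b s1 -> in_interval a b s2 -> s1 <= s <= s2 ->
  in_interval a b s.
Proof.
  intros [h1 _] [_ h2] [l1 l2]; split.
  - apply Rbar_lt_le_trans with (1 := h1); exact l1.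
  - apply Rbar_le_lt_trans with (2 := h2); exact l2.
Qed.

Lemma in_interval_inhabited (a b : Rbar) :
  Rbar_lt a b -> exists s : R, in_interval a b s.
Proof.
  unfold in_interval; destruct a as [a| |], b as [b| |]; simpl; intros h;
    try contradiction.
  - exists ((a + b) / 2); simpl; lra.
  - exists (a + 1); simpl; lra.
  - exists (b - 1); simpl; lra.
  - exists 0; simpl; auto.
Qed.

Lemma constant_of_zero_derivative (a b : Rbar) (f : R -> R) :
  (forall s, in_interval a b s -> is_derive f s 0) ->
  forall s1 s2, in_interval a b s1 -> in_interval a b s2 -> f s1 = f s2.
Proof.
  intros hf.
  assert (lt_case : forall s1 s2, in_interval a b s1 -> in_interval a b s2 ->
            s1 < s2 -> f s1 = f s2).
  { intros s1 s2 h1 h2 l.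
    apply (@eq_is_derive R_NormedModule f s1 s2); [|exact l].
    intros s hs; apply hf; exact (in_interval_convex a b s1 s2 s h1 h2 hs). }
  intros s1 s2 h1 h2; destruct (Rtotal_order s1 s2) as [l|[e|l]].
  - now apply lt_case.
  - now rewrite e.
  - symmetry; now apply lt_case.
Qed.

Lemma derive_zero_of_constant (a b : Rbar) (f : R -> R) (k s : R) :
  (forall v, in_interval a b v -> f v = k) -> in_interval a b s ->
  Derive f s = 0.
Proof.
  intros hk hs.
  rewrite (Derive_ext_loc _ (fun _ => k)); [apply Derive_const|].
  eapply filter_imp; [|exact (in_interval_locally a b s hs)]; exact hk.
Qed.

(** Where [f^2 = k <> 0], differentiating gives [2 f f' = 0], hence [f' = 0]. *)
Lemma constant_of_constant_square (a b : Rbar) (f : R -> R) (k : R) :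
  (forall s, in_interval a b s -> ex_derive f s) ->
  (forall s, in_interval a b s -> f s ^ 2 = k) ->
  forall s1 s2, in_interval a b s1 -> in_interval a b s2 -> f s1 = f s2.
Proof.
  intros df sq; destruct (Req_dec k 0) as [k0|k0].
  - intros s1 s2 h1 h2.
    pose proof (sq s1 h1) as e1; pose proof (sq s2 h2) as e2.
    assert (f s1 = 0) by nra; assert (f s2 = 0) by nra; lra.
  - apply constant_of_zero_derivative; intros s hs.
    assert (d2 : Derive (fun v => f v ^ 2) s = 2 * f s * Derive f s).
    { apply is_derive_unique; auto_derive; [now apply df|].
      change (fun v => f v) with f; ring. }
    pose proof (derive_zero_of_constant a b _ k s sq hs) as z.
    replace 0 with (Derive f s); [now apply Derive_correct, df|].
    apply Rmult_eq_reg_l with (2 * f s); [lra|].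
    intros fs0; apply k0; rewrite <- (sq s hs).
    replace (f s) with 0 by lra; ring.
Qed.

(** The differential operators at a point of the strip depend only on the germ
    there, so a formula valid on the strip may be substituted under any number
    of derivatives, even though junk values outside the strip differ. *)
Definition agree (a b : Rbar) (F H : scalar_field) : Prop :=
  forall t s, in_interval a b s -> F t s = H t s.

Lemma partial_agree (a b : Rbar) (i : coord) (F H : scalar_field) :
  agree a b F H -> agree a b (partial i F) (partial i H).
Proof.
  intros e t s hs; destruct i; simpl.
  - apply Derive_ext; intros u; now apply e.
  - apply Derive_ext_loc.
    eapply filter_imp; [|exact (in_interval_locally a b s hs)].
    intros v hv; now apply e.
Qed.

(** * Intrinsic geometry of the rotation surface *)

Record profile (a b : Rbar) (eps1 : R) (x y : R -> R) : Prop := {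
  profile_dx : forall s, in_interval a b s -> ex_derive x s;
  profile_dy : forall s, in_interval a b s -> ex_derive y s;
  profile_ddx : forall s, in_interval a b s -> ex_derive (Derive x) s;
  profile_ddy : forall s, in_interval a b s -> ex_derive (Derive y) s;
  profile_sign : eps1 ^ 2 = 1;
  profile_unit : forall s, in_interval a b s ->
    Derive x s ^ 2 - Derive y s ^ 2 = 1;
  profile_nondeg : forall s, in_interval a b s ->
    0 < eps1 * (y s ^ 2 - x s ^ 2)
}.

(** Closes differentiability side goals; the facts are applied rather than looked
    up because goals produced by differentiation are stated for [fun v => x v]. *)
Ltac profile_diff hp :=
  try first
    [ now apply (profile_dx _ _ _ _ _ hp)
    | now apply (profile_dy _ _ _ _ _ hp)
    | now apply (profile_ddx _ _ _ _ _ hp)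
    | now apply (profile_ddy _ _ _ _ _ hp) ].

(** The length of [d/dt], up to causal character. *)
Definition radius (eps1 : R) (x y : R -> R) (s : R) : R :=
  sqrt (eps1 * (y s ^ 2 - x s ^ 2)).

Lemma partial_ct_component (x y : R -> R) (c : axis) (t s : R) :
  partial ct (component (rotation_surface x y) c) t s
  = vec4 (- x s * sin t) (x s * cos t) (- y s * sin t) (y s * cos t) c.
Proof.
  destruct c; apply is_derive_unique; unfold component, rotation_surface;
    simpl; auto_derive; trivial; ring.
Qed.

Lemma partial_cs_component (x y : R -> R) (c : axis) (t s : R) :
  partial cs (component (rotation_surface x y) c) t s
  = vec4 (Derive x s * cos t) (Derive x s * sin t)
      (Derive y s * cos t) (Derive y s * sin t) c.
Proof.
  destruct c; unfold component, rotation_surface; simpl; apply Derive_scal_l.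
Qed.

Lemma act_coord_field (i : coord) (F : scalar_field) :
  act (coord_field i) F = partial i F.
Proof.
  apply functional_extensionality; intros t;
    apply functional_extensionality; intros s.
  unfold act, csum; destruct i; simpl; ring.
Qed.

Lemma push_coord_field (phi : surface) (i : coord) (t s : R) (c : axis) :
  push phi (coord_field i) t s c = partial i (component phi c) t s.
Proof. unfold push; now rewrite act_coord_field. Qed.

Lemma sin_sqr (t : R) : sin t ^ 2 = 1 - cos t ^ 2.
Proof. pose proof (sin2_cos2 t) as h; unfold Rsqr in h; lra. Qed.

Lemma metric_rotation (a b : Rbar) (eps1 : R) (x y : R -> R) (i j : coord) :
  profile a b eps1 x y ->
  agree a b (metric (rotation_surface x y) i j)
    (fun _ s => match i, j with
                | ct, ct => x s ^ 2 - y s ^ 2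
                | cs, cs => 1
                | _, _ => 0
                end).
Proof.
  intros hp t s hs; pose proof (profile_unit _ _ _ _ _ hp s hs) as u.
  unfold metric, inner; rewrite !push_coord_field.
  destruct i, j; rewrite ?partial_ct_component, ?partial_cs_component; simpl.
  - ring_simplify; rewrite !sin_sqr; ring.
  - ring.
  - ring.
  - rewrite <- u; ring_simplify; rewrite !sin_sqr; ring.
Qed.

Lemma profile_det_neq0 (a b : Rbar) (eps1 : R) (x y : R -> R) (s : R) :
  profile a b eps1 x y -> in_interval a b s -> x s ^ 2 - y s ^ 2 <> 0.
Proof.
  intros hp hs e; pose proof (profile_nondeg _ _ _ _ _ hp s hs) as n.
  replace (y s ^ 2 - x s ^ 2) with 0 in n by lra; lra.
Qed.

Lemma partial_metric_rotation (a b : Rbar) (eps1 : R) (x y : R -> R)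
  (k i j : coord) :
  profile a b eps1 x y ->
  agree a b (partial k (metric (rotation_surface x y) i j))
    (fun _ s => match k, i, j with
                | cs, ct, ct => 2 * (x s * Derive x s - y s * Derive y s)
                | _, _, _ => 0
                end).
Proof.
  intros hp t s hs.
  rewrite (partial_agree _ _ _ _ _ (metric_rotation _ _ _ _ _ i j hp) t s hs).
  destruct k, i, j; simpl; try apply Derive_const.
  apply is_derive_unique; auto_derive.
  - repeat split; profile_diff hp.
  - change (fun v => x v) with x; change (fun v => y v) with y; ring.
Qed.

(** [E' / (2 E)] for [E = <d_t, d_t> = x^2 - y^2]:
    the logarithmic derivative of [radius]. *)
Definition log_slope (x y : R -> R) (s : R) : R :=
  (x s * Derive x s - y s * Derive y s) / (x s ^ 2 - y s ^ 2).

Lemma christoffel_rotation (a b : Rbar) (eps1 : R) (x y : R -> R)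
  (k i j : coord) :
  profile a b eps1 x y ->
  agree a b (christoffel (rotation_surface x y) k i j)
    (fun _ s => match k, i, j with
                | ct, ct, cs | ct, cs, ct => log_slope x y s
                | cs, ct, ct => y s * Derive y s - x s * Derive x s
                | _, _, _ => 0
                end).
Proof.
  intros hp t s hs; pose proof (profile_det_neq0 _ _ _ _ _ s hp hs) as nz.
  unfold christoffel, csum, log_slope.
  rewrite !(partial_metric_rotation _ _ _ _ _ _ _ _ hp t s hs).
  unfold metric_inv, metric_det.
  destruct k, i, j; rewrite !(metric_rotation _ _ _ _ _ _ _ hp t s hs);
    field; trivial.
Qed.

Lemma nabla_coord_field (phi : surface) (i j k : coord) :
  nabla phi (coord_field i) (coord_field j) k = christoffel phi k i j.
Proof.
  apply functional_extensionality; intros t;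
    apply functional_extensionality; intros s.
  unfold nabla; rewrite act_coord_field; unfold csum.
  replace (partial i (coord_field j k) t s) with 0.
  - destruct i, j; simpl; ring.
  - destruct i, j, k; simpl; symmetry; apply Derive_const.
Qed.

Lemma nabla_coord (phi : surface) (i : coord) (Y : vector_field)
  (k : coord) (t s : R) :
  nabla phi (coord_field i) Y k t s
  = partial i (Y k) t s
    + csum (fun j => christoffel phi k i j t s * Y j t s).
Proof.
  unfold nabla; rewrite act_coord_field; unfold csum.
  destruct i; simpl; ring.
Qed.

(** With [log_slope = q' / q] the right-hand side is the classical
    [- q'' / q]. *)
Lemma gauss_curvature_rotation (a b : Rbar) (eps1 : R) (x y : R -> R) :
  profile a b eps1 x y ->
  agree a b (gauss_curvature (rotation_surface x y))
    (fun _ s => - (Derive (log_slope x y) s + log_slope x y s ^ 2)).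
Proof.
  intros hp t s hs; pose proof (profile_det_neq0 _ _ _ _ _ s hp hs) as nz.
  unfold gauss_curvature, metric_prod, metric_det, csum.
  rewrite !(metric_rotation _ _ _ _ _ _ _ hp t s hs), !nabla_coord; unfold csum.
  rewrite !nabla_coord_field.
  rewrite !(partial_agree _ _ _ _ _ (christoffel_rotation _ _ _ _ _ _ _ _ hp) t s hs).
  rewrite !(christoffel_rotation _ _ _ _ _ _ _ _ hp t s hs).
  simpl; rewrite !Derive_const.
  change (fun v => log_slope x y v) with (log_slope x y).
  field; intros z; apply nz; rewrite <- z; ring.
Qed.

Lemma radius_pos (a b : Rbar) (eps1 : R) (x y : R -> R) (s : R) :
  profile a b eps1 x y -> in_interval a b s -> 0 < radius eps1 x y s.
Proof. intros hp hs; apply sqrt_lt_R0, (profile_nondeg _ _ _ _ _ hp s hs). Qed.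

Lemma radius_sqr (a b : Rbar) (eps1 : R) (x y : R -> R) (s : R) :
  profile a b eps1 x y -> in_interval a b s ->
  x s ^ 2 - y s ^ 2 = - eps1 * radius eps1 x y s ^ 2.
Proof.
  intros hp hs; unfold radius.
  rewrite pow2_sqrt by (apply Rlt_le, (profile_nondeg _ _ _ _ _ hp s hs)).
  replace (- eps1 * (eps1 * (y s ^ 2 - x s ^ 2)))
    with (eps1 ^ 2 * (x s ^ 2 - y s ^ 2)) by ring.
  rewrite (profile_sign _ _ _ _ _ hp); ring.
Qed.

Lemma sign_neq0 (e : R) : e ^ 2 = 1 -> e <> 0.
Proof. intros h e0; rewrite e0 in h; lra. Qed.

Lemma is_derive_radius (a b : Rbar) (eps1 : R) (x y : R -> R) (s : R) :
  profile a b eps1 x y -> in_interval a b s ->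
  is_derive (radius eps1 x y) s (log_slope x y s * radius eps1 x y s).
Proof.
  intros hp hs.
  pose proof (radius_pos _ _ _ _ _ s hp hs) as qpos.
  pose proof (radius_sqr _ _ _ _ _ s hp hs) as q2.
  pose proof (profile_sign _ _ _ _ _ hp) as e2.
  pose proof (sign_neq0 _ e2) as e0.
  unfold radius at 1; auto_derive.
  - repeat split.
    + profile_diff hp.
    + profile_diff hp.
    + pose proof (profile_nondeg _ _ _ _ _ hp s hs) as n; simpl in n; lra.
  - unfold log_slope; rewrite q2.
    replace (eps1 * (y s * (y s * 1) + - (x s * (x s * 1))))
      with (eps1 * (y s ^ 2 - x s ^ 2)) by ring.
    fold (radius eps1 x y s).
    assert (inv : / eps1 = eps1) by (field_simplify_eq; trivial; lra).
    replace ((x s * Derive x s - y s * Derive y s)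
             / (- eps1 * radius eps1 x y s ^ 2) * radius eps1 x y s)
      with ((y s * Derive y s - x s * Derive x s) * / eps1 / radius eps1 x y s)
      by (field; lra).
    rewrite inv.
    change (fun v => x v) with x; change (fun v => y v) with y; field; lra.
Qed.

(** [alpha] is the slope of the radius; [c] is the constant value of
    [(x' y - x y') / q], which measures the failure of the profile curve to be
    a line through the origin. *)
Record flat_profile (a b : Rbar) (eps1 : R) (x y : R -> R) (alpha c : R)
  : Prop := {
  flat_dradius : forall s, in_interval a b s ->
    is_derive (radius eps1 x y) s alpha;
  flat_dx : forall s, in_interval a b s ->
    is_derive x s ((alpha * x s + eps1 * c * y s) / radius eps1 x y s);
  flat_dy : forall s, in_interval a b s ->
    is_derive y s ((alpha * y s + eps1 * c * x s) / radius eps1 x y s);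
  flat_const : c ^ 2 = alpha ^ 2 + eps1
}.

(** The tangent [(x', y')] is recovered from its two products with the position
    vector, [x x' - y y' = - eps1 alpha q] and [x' y - x y' = c q]; the first is
    the flatness equation integrated once.  The second quotient has a constant
    square by the Lagrange identity, hence is itself constant. *)
Lemma flat_profile_of_flat (a b : Rbar) (eps1 : R) (x y : R -> R) :
  Rbar_lt a b -> profile a b eps1 x y -> flat a b (rotation_surface x y) ->
  exists alpha c : R, flat_profile a b eps1 x y alpha c.
Proof.
  intros hab hp hflat.
  destruct (in_interval_inhabited a b hab) as [s0 hs0].
  pose proof (profile_sign _ _ _ _ _ hp) as e2.
  pose proof (sign_neq0 _ e2) as e0.
  set (q := radius eps1 x y).
  set (slope := fun s => log_slope x y s * q s).
  set (w := fun s => (Derive x s * y s - x s * Derive y s) / q s).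
  assert (dlog : forall s, in_interval a b s -> ex_derive (log_slope x y) s).
  { intros s hs; unfold log_slope; auto_derive; repeat split;
      profile_diff hp.
    pose proof (profile_det_neq0 _ _ _ _ _ s hp hs) as nz; intros z.
    apply nz; rewrite <- z; ring. }
  (* (q' / q) q has derivative (Derive (q' / q) + (q' / q)^2) q, which is
     minus the curvature times q. *)
  assert (slope_const : forall s, in_interval a b s -> slope s = slope s0).
  { intros s hs; apply (constant_of_zero_derivative a b); trivial.
    clear s hs; intros s hs.
    pose proof (hflat 0 s hs) as k.
    rewrite (gauss_curvature_rotation _ _ _ _ _ hp 0 s hs) in k.
    pose proof (is_derive_radius _ _ _ _ _ s hp hs) as dq.
    unfold slope; auto_derive.
    - repeat split; [now apply dlog|].
      eexists; exact dq.
    - change (fun v => log_slope x y v) with (log_slope x y).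
      change (fun v => q v) with (radius eps1 x y).
      rewrite (is_derive_unique _ _ _ dq).
      change (q s) with (radius eps1 x y s).
      replace (Derive (log_slope x y) s) with (- log_slope x y s ^ 2) by lra.
      ring. }
  assert (rad : forall s, in_interval a b s ->
    x s * Derive x s - y s * Derive y s = - eps1 * slope s0 * q s).
  { intros s hs; rewrite <- (slope_const s hs); unfold slope, log_slope, q.
    pose proof (profile_det_neq0 _ _ _ _ _ s hp hs) as nz.
    transitivity ((x s * Derive x s - y s * Derive y s)
      / (x s ^ 2 - y s ^ 2) * (- eps1 * radius eps1 x y s ^ 2)).
    - rewrite <- (radius_sqr _ _ _ _ _ s hp hs); field; trivial.
    - ring. }
  assert (w_sqr : forall s, in_interval a b s -> w s ^ 2 = slope s0 ^ 2 + eps1).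
  { intros s hs; unfold w.
    pose proof (radius_pos _ _ _ _ _ s hp hs) as qpos; fold q in qpos.
    pose proof (radius_sqr _ _ _ _ _ s hp hs) as q2; fold q in q2.
    pose proof (profile_unit _ _ _ _ _ hp s hs) as u.
    assert (lag : (Derive x s * y s - x s * Derive y s) ^ 2
      = (x s * Derive x s - y s * Derive y s) ^ 2
        - (x s ^ 2 - y s ^ 2) * (Derive x s ^ 2 - Derive y s ^ 2)) by ring.
    rewrite u, (rad s hs), q2 in lag.
    replace (((Derive x s * y s - x s * Derive y s) / q s) ^ 2)
      with ((Derive x s * y s - x s * Derive y s) ^ 2 / q s ^ 2)
      by (field; lra).
    rewrite lag.
    replace ((- eps1 * slope s0 * q s) ^ 2)
      with (eps1 ^ 2 * (slope s0 * q s) ^ 2) by ring.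
    rewrite e2; field; lra. }
  assert (w_const : forall s, in_interval a b s -> w s = w s0).
  { intros s hs; apply (constant_of_constant_square a b _ (slope s0 ^ 2 + eps1));
      trivial.
    clear s hs; intros s hs.
    pose proof (radius_pos _ _ _ _ _ s hp hs) as qpos; fold q in qpos.
    unfold w; auto_derive; repeat split;
      profile_diff hp.
    - eexists; exact (is_derive_radius _ _ _ _ _ s hp hs).
    - lra. }
  assert (ang : forall s, in_interval a b s ->
    Derive x s * y s - x s * Derive y s = w s0 * q s).
  { intros s hs; rewrite <- (w_const s hs); unfold w.
    pose proof (radius_pos _ _ _ _ _ s hp hs) as qpos; fold q in qpos.
    field; lra. }
  exists (slope s0), (w s0); split.
  - intros s hs; rewrite <- (slope_const s hs).
    exact (is_derive_radius _ _ _ _ _ s hp hs).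
  - intros s hs; fold q.
    pose proof (radius_pos _ _ _ _ _ s hp hs) as qpos; fold q in qpos.
    pose proof (radius_sqr _ _ _ _ _ s hp hs) as q2; fold q in q2.
    replace ((slope s0 * x s + eps1 * w s0 * y s) / q s) with (Derive x s);
      [now apply Derive_correct, (profile_dx _ _ _ _ _ hp)|].
    apply Rmult_eq_reg_r with (- eps1 * q s ^ 2); [|nra].
    (* Cramer's rule for x' in the two product equations; the determinant is
       x^2 - y^2 = - eps1 q^2. *)
    transitivity (x s * (x s * Derive x s - y s * Derive y s)
                  - y s * (Derive x s * y s - x s * Derive y s));
      [rewrite <- q2; ring|].
    rewrite (rad s hs), (ang s hs).
    replace (w s0 * q s) with (eps1 ^ 2 * (w s0 * q s)) by (rewrite e2; ring).
    field; lra.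
  - intros s hs; fold q.
    pose proof (radius_pos _ _ _ _ _ s hp hs) as qpos; fold q in qpos.
    pose proof (radius_sqr _ _ _ _ _ s hp hs) as q2; fold q in q2.
    replace ((slope s0 * y s + eps1 * w s0 * x s) / q s) with (Derive y s);
      [now apply Derive_correct, (profile_dy _ _ _ _ _ hp)|].
    apply Rmult_eq_reg_r with (- eps1 * q s ^ 2); [|nra].
    transitivity (y s * (x s * Derive x s - y s * Derive y s)
                  - x s * (Derive x s * y s - x s * Derive y s));
      [rewrite <- q2; ring|].
    rewrite (rad s hs), (ang s hs).
    replace (w s0 * q s) with (eps1 ^ 2 * (w s0 * q s)) by (rewrite e2; ring).
    field; lra.
  - now apply w_sqr.
Qed.

(** * Connection and Laplacian of a flat surface *)

Lemma act_frame1 (eps1 : R) (x y : R -> R) (F : scalar_field) (t s : R) :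
  act (frame1 eps1 x y) F t s = partial ct F t s / radius eps1 x y s.
Proof. unfold act, csum, frame1, radius, Rdiv; simpl; ring. Qed.

Lemma flat_Derive_x (a b : Rbar) (eps1 : R) (x y : R -> R) (alpha c s : R) :
  flat_profile a b eps1 x y alpha c -> in_interval a b s ->
  Derive x s = (alpha * x s + eps1 * c * y s) / radius eps1 x y s.
Proof. intros hf hs; now apply is_derive_unique, (flat_dx _ _ _ _ _ _ _ hf). Qed.

Lemma flat_Derive_y (a b : Rbar) (eps1 : R) (x y : R -> R) (alpha c s : R) :
  flat_profile a b eps1 x y alpha c -> in_interval a b s ->
  Derive y s = (alpha * y s + eps1 * c * x s) / radius eps1 x y s.
Proof. intros hf hs; now apply is_derive_unique, (flat_dy _ _ _ _ _ _ _ hf). Qed.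

Lemma christoffel_flat (a b : Rbar) (eps1 : R) (x y : R -> R) (alpha c : R)
  (k i j : coord) :
  profile a b eps1 x y -> flat_profile a b eps1 x y alpha c ->
  agree a b (christoffel (rotation_surface x y) k i j)
    (fun _ s => match k, i, j with
                | ct, ct, cs | ct, cs, ct => alpha / radius eps1 x y s
                | cs, ct, ct => eps1 * alpha * radius eps1 x y s
                | _, _, _ => 0
                end).
Proof.
  intros hp hf t s hs.
  pose proof (radius_pos _ _ _ _ _ s hp hs) as qpos.
  pose proof (radius_sqr _ _ _ _ _ s hp hs) as q2.
  pose proof (profile_det_neq0 _ _ _ _ _ s hp hs) as nz.
  rewrite (christoffel_rotation _ _ _ _ _ _ _ _ hp t s hs).
  assert (rad : x s * Derive x s - y s * Derive y s
                = alpha * (x s ^ 2 - y s ^ 2) / radius eps1 x y s).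
  { rewrite (flat_Derive_x _ _ _ _ _ _ _ s hf hs),
      (flat_Derive_y _ _ _ _ _ _ _ s hf hs); field; lra. }
  destruct k, i, j; trivial; unfold log_slope.
  - rewrite rad; field; split; [lra|].
    intros z; apply nz; rewrite <- z; ring.
  - rewrite rad; field; split; [lra|].
    intros z; apply nz; rewrite <- z; ring.
  - transitivity (- (alpha * (x s ^ 2 - y s ^ 2) / radius eps1 x y s)).
    + rewrite <- rad; ring.
    + rewrite q2; field; lra.
Qed.

(** Here [<e_1, e_1> = - eps1], [nabla_(e_1) e_1 = (eps1 alpha / q) d_s] and
    [nabla_(e_2) e_2 = 0]. *)
Lemma laplacian_flat (a b : Rbar) (eps1 : R) (x y : R -> R) (alpha c : R)
  (F : scalar_field) :
  profile a b eps1 x y -> flat_profile a b eps1 x y alpha c ->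
  agree a b
    (laplacian (rotation_surface x y) (frame1 eps1 x y) frame2 F)
    (fun t s => eps1 / radius eps1 x y s ^ 2 * partial ct (partial ct F) t s
                - alpha / radius eps1 x y s * partial cs F t s
                - partial cs (partial cs F) t s).
Proof.
  intros hp hf t s hs.
  pose proof (radius_pos _ _ _ _ _ s hp hs) as qpos.
  pose proof (radius_sqr _ _ _ _ _ s hp hs) as q2.
  pose proof (profile_sign _ _ _ _ _ hp) as e2.
  unfold laplacian, frame2.
  rewrite !act_coord_field, act_frame1.
  replace (partial ct (act (frame1 eps1 x y) F) t s)
    with (partial ct (partial ct F) t s / radius eps1 x y s).
  2:{ transitivity (Derive (fun u => partial ct F u s * / radius eps1 x y s) t).
      - symmetry; apply Derive_scal_l.
      - apply Derive_ext; intros u; symmetry; apply act_frame1. }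
  assert (n11 : forall k, nabla (rotation_surface x y) (frame1 eps1 x y)
      (frame1 eps1 x y) k t s
      = christoffel (rotation_surface x y) k ct ct t s / radius eps1 x y s ^ 2).
  { intros k; unfold nabla; rewrite act_frame1.
    replace (partial ct (frame1 eps1 x y k) t s) with 0
      by (destruct k; symmetry;
          [ exact (Derive_const (1 / radius eps1 x y s) t)
          | exact (Derive_const (0 / radius eps1 x y s) t) ]).
    unfold csum, frame1; fold (radius eps1 x y s); simpl; field; lra. }
  unfold act at 1; unfold csum; rewrite !n11.
  unfold act, csum; rewrite !nabla_coord_field.
  rewrite !(christoffel_flat _ _ _ _ _ _ _ _ _ _ hp hf t s hs).
  unfold metric_prod, csum; rewrite !(metric_rotation _ _ _ _ _ _ _ hp t s hs).
  unfold frame1; fold (radius eps1 x y s); simpl coord_field; cbv iota.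
  rewrite q2; field_simplify; [|lra|lra].
  rewrite ?e2; field; lra.
Qed.

Lemma laplacian_agree (a b : Rbar) (eps1 : R) (x y : R -> R) (alpha c : R)
  (F H : scalar_field) :
  profile a b eps1 x y -> flat_profile a b eps1 x y alpha c ->
  agree a b F H ->
  agree a b
    (laplacian (rotation_surface x y) (frame1 eps1 x y) frame2 F)
    (laplacian (rotation_surface x y) (frame1 eps1 x y) frame2 H).
Proof.
  intros hp hf e t s hs.
  rewrite !(laplacian_flat _ _ _ _ _ _ _ _ hp hf t s hs).
  pose proof (fun i => partial_agree _ _ i _ _ e) as e1.
  now rewrite (e1 cs t s hs), (partial_agree _ _ _ _ _ (e1 ct) t s hs),
    (partial_agree _ _ _ _ _ (e1 cs) t s hs).
Qed.

(** * Second fundamental form *)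

Lemma is_derive_flat_slope (a b : Rbar) (eps1 : R) (x y : R -> R)
  (alpha c s : R) :
  profile a b eps1 x y -> flat_profile a b eps1 x y alpha c ->
  in_interval a b s ->
  is_derive (fun v => (alpha * x v + eps1 * c * y v) / radius eps1 x y v) s
    (c * (c * x s + eps1 * alpha * y s) / radius eps1 x y s ^ 2)
  /\
  is_derive (fun v => (alpha * y v + eps1 * c * x v) / radius eps1 x y v) s
    (c * (c * y s + eps1 * alpha * x s) / radius eps1 x y s ^ 2).
Proof.
  intros hp hf hs.
  pose proof (radius_pos _ _ _ _ _ s hp hs) as qpos.
  pose proof (profile_sign _ _ _ _ _ hp) as e2.
  pose proof (flat_dradius _ _ _ _ _ _ _ hf s hs) as dq.
  pose proof (flat_dx _ _ _ _ _ _ _ hf s hs) as dx.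
  pose proof (flat_dy _ _ _ _ _ _ _ hf s hs) as dy.
  split; auto_derive;
    try (repeat split; solve [ eexists; eassumption | lra ]).
  all: change (fun v => x v) with x; change (fun v => y v) with y;
    change (fun v => radius eps1 x y v) with (radius eps1 x y);
    rewrite (is_derive_unique _ _ _ dx), (is_derive_unique _ _ _ dy),
      (is_derive_unique _ _ _ dq).
  all: field [e2]; lra.
Qed.

(** The factor [c] decides whether the surface is curved in the ambient space:
    the mixed component of the other factor does not vanish, since
    [x^2 <> y^2]. *)
Lemma second_fundamental_form_flat (a b : Rbar) (eps1 : R) (x y : R -> R)
  (alpha c : R) (i j : coord) (t s : R) (ax : axis) :
  profile a b eps1 x y -> flat_profile a b eps1 x y alpha c ->
  in_interval a b s ->
  second_fundamental_form (rotation_surface x y)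
    (coord_field i) (coord_field j) t s ax
  = c * match i, j with
        | ct, ct =>
            vec4 (- (eps1 * c * x s + alpha * y s) * cos t)
                 (- (eps1 * c * x s + alpha * y s) * sin t)
                 (- (eps1 * c * y s + alpha * x s) * cos t)
                 (- (eps1 * c * y s + alpha * x s) * sin t) ax
        | cs, cs =>
            vec4 ((c * x s + eps1 * alpha * y s) / radius eps1 x y s ^ 2 * cos t)
                 ((c * x s + eps1 * alpha * y s) / radius eps1 x y s ^ 2 * sin t)
                 ((c * y s + eps1 * alpha * x s) / radius eps1 x y s ^ 2 * cos t)
                 ((c * y s + eps1 * alpha * x s) / radius eps1 x y s ^ 2 * sin t)
                 ax
        | _, _ =>
            vec4 (- (eps1 * y s / radius eps1 x y s) * sin t)
                 (eps1 * y s / radius eps1 x y s * cos t)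
                 (- (eps1 * x s / radius eps1 x y s) * sin t)
                 (eps1 * x s / radius eps1 x y s * cos t) ax
        end.
Proof.
  intros hp hf hs.
  pose proof (radius_pos _ _ _ _ _ s hp hs) as qpos.
  pose proof (profile_sign _ _ _ _ _ hp) as e2.
  pose proof (flat_const _ _ _ _ _ _ _ hf) as c2.
  set (q := radius eps1 x y) in *.
  assert (first : forall l, agree a b
    (partial l (component (rotation_surface x y) ax))
    (fun u v => match l with
      | ct => vec4 (- x v * sin u) (x v * cos u) (- y v * sin u) (y v * cos u) ax
      | cs => vec4 ((alpha * x v + eps1 * c * y v) / q v * cos u)
                   ((alpha * x v + eps1 * c * y v) / q v * sin u)
                   ((alpha * y v + eps1 * c * x v) / q v * cos u)
                   ((alpha * y v + eps1 * c * x v) / q v * sin u) ax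
      end)).
  { intros l u v hv; destruct l.
    - apply partial_ct_component.
    - rewrite partial_cs_component, (flat_Derive_x _ _ _ _ _ _ _ v hf hv),
        (flat_Derive_y _ _ _ _ _ _ _ v hf hv); reflexivity. }
  assert (dcos : Derive cos t = - sin t)
    by (apply is_derive_unique; auto_derive; trivial; ring).
  assert (dsin : Derive sin t = cos t)
    by (apply is_derive_unique; auto_derive; trivial; ring).
  assert (ddx : Derive (fun v => (alpha * x v + eps1 * c * y v) / q v) s
                = c * (c * x s + eps1 * alpha * y s) / q s ^ 2).
  { apply is_derive_unique, (is_derive_flat_slope a b _ _ _ _ _ _ hp hf hs). }
  assert (ddy : Derive (fun v => (alpha * y v + eps1 * c * x v) / q v) s
                = c * (c * y s + eps1 * alpha * x s) / q s ^ 2).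
  { apply is_derive_unique, (is_derive_flat_slope a b _ _ _ _ _ _ hp hf hs). }
  unfold second_fundamental_form; rewrite !act_coord_field.
  unfold act, csum; rewrite !nabla_coord_field.
  rewrite !(christoffel_flat _ _ _ _ _ _ _ _ _ _ hp hf t s hs), !(first _ t s hs).
  fold q; fold (q s).
  rewrite (partial_agree _ _ _ _ _ (first j) t s hs).
  destruct i, j, ax; simpl; rewrite ?Derive_scal, ?Derive_scal_l, ?Derive_opp;
    change (fun v => x v) with x; change (fun v => y v) with y;
    rewrite ?dcos, ?dsin, ?ddx, ?ddy,
      ?(flat_Derive_x _ _ _ _ _ _ _ s hf hs),
      ?(flat_Derive_y _ _ _ _ _ _ _ s hf hs); fold q; fold (q s);
    field [c2 e2]; lra.
Qed.

Lemma totally_geodesic_iff_flat (a b : Rbar) (eps1 : R) (x y : R -> R)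
  (alpha c : R) :
  Rbar_lt a b -> profile a b eps1 x y -> flat_profile a b eps1 x y alpha c ->
  totally_geodesic a b (rotation_surface x y) <-> c = 0.
Proof.
  intros hab hp hf; split.
  - intros tg; destruct (in_interval_inhabited a b hab) as [s hs].
    pose proof (radius_pos _ _ _ _ _ s hp hs) as qpos.
    pose proof (sign_neq0 _ (profile_sign _ _ _ _ _ hp)) as e0.
    pose proof (profile_det_neq0 _ _ _ _ _ s hp hs) as nz.
    (* At t = 0 the second and fourth coordinates of the mixed component are
       c y and c x up to a common nonzero factor. *)
    pose proof (tg 0 s hs ct cs X2) as hy.
    pose proof (tg 0 s hs ct cs X4) as hx.
    rewrite (second_fundamental_form_flat a b eps1 _ _ alpha c) in hx, hy by trivial.
    simpl in hx, hy; rewrite cos_0 in hx, hy.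
    destruct (Req_dec c 0) as [c0|c0]; [exact c0|exfalso].
    assert (cancel : forall z,
      c * (eps1 * z / radius eps1 x y s * 1) = 0 -> z = 0).
    { intros z hz.
      replace z with (c * (eps1 * z / radius eps1 x y s * 1)
                      * (radius eps1 x y s / (c * eps1))) by (field; lra).
      rewrite hz; ring. }
    apply cancel in hx; apply cancel in hy.
    apply nz; rewrite hx, hy; ring.
  - intros c0 t s hs i j ax.
    rewrite (second_fundamental_form_flat a b eps1 _ _ alpha c) by trivial.
    rewrite c0; ring.
Qed.

(** * The Gauss map and its Laplacian *)

(** [(x x' + y y') / q], rewritten with the linear system so that no derivative
    of [x] or [y] is left. *)
Definition boost_cos (eps1 : R) (x y : R -> R) (alpha c s : R) : R :=
  (alpha * (x s ^ 2 + y s ^ 2) + 2 * eps1 * c * x s * y s)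
  / radius eps1 x y s ^ 2.

(** [(x y' + x' y) / q], rewritten in the same way. *)
Definition boost_sin (eps1 : R) (x y : R -> R) (alpha c s : R) : R :=
  (2 * alpha * x s * y s + eps1 * c * (x s ^ 2 + y s ^ 2))
  / radius eps1 x y s ^ 2.

(** [boost_cos + boost_sin] and [boost_cos - boost_sin] are proportional to
    [(x + y)^2 / q^2] and [(x - y)^2 / q^2], and [x + y], [x - y] are
    eigenfunctions of the linear system for [alpha + eps1 c] and
    [alpha - eps1 c]; the pair thus undergoes a hyperbolic rotation. *)
Lemma is_derive_boost (a b : Rbar) (eps1 : R) (x y : R -> R) (alpha c s : R) :
  profile a b eps1 x y -> flat_profile a b eps1 x y alpha c ->
  in_interval a b s ->
  is_derive (boost_cos eps1 x y alpha c) s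
    (2 * eps1 * c / radius eps1 x y s * boost_sin eps1 x y alpha c s)
  /\
  is_derive (boost_sin eps1 x y alpha c) s
    (2 * eps1 * c / radius eps1 x y s * boost_cos eps1 x y alpha c s).
Proof.
  intros hp hf hs.
  pose proof (radius_pos _ _ _ _ _ s hp hs) as qpos.
  pose proof (flat_dradius _ _ _ _ _ _ _ hf s hs) as dq.
  pose proof (flat_dx _ _ _ _ _ _ _ hf s hs) as dx.
  pose proof (flat_dy _ _ _ _ _ _ _ hf s hs) as dy.
  unfold boost_cos, boost_sin; split; auto_derive;
    try (repeat split; solve [ eexists; eassumption | apply pow_nonzero; lra | nra ]).
  all: change (fun v => x v) with x; change (fun v => y v) with y;
    change (fun v => radius eps1 x y v) with (radius eps1 x y);
    rewrite (is_derive_unique _ _ _ dx), (is_derive_unique _ _ _ dy),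
      (is_derive_unique _ _ _ dq).
  all: field; lra.
Qed.

Lemma boost_hyperbola (a b : Rbar) (eps1 : R) (x y : R -> R) (alpha c s : R) :
  profile a b eps1 x y -> flat_profile a b eps1 x y alpha c ->
  in_interval a b s ->
  boost_cos eps1 x y alpha c s ^ 2 - boost_sin eps1 x y alpha c s ^ 2 = - eps1.
Proof.
  intros hp hf hs.
  pose proof (radius_pos _ _ _ _ _ s hp hs) as qpos.
  pose proof (radius_sqr _ _ _ _ _ s hp hs) as q2.
  pose proof (profile_sign _ _ _ _ _ hp) as e2.
  pose proof (flat_const _ _ _ _ _ _ _ hf) as c2.
  unfold boost_cos, boost_sin; set (q := radius eps1 x y s) in *.
  transitivity ((alpha ^ 2 - eps1 ^ 2 * c ^ 2) * (x s ^ 2 - y s ^ 2) ^ 2 / q ^ 4).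
  - field; lra.
  - rewrite q2; field [c2 e2]; lra.
Qed.

(** Elements of a space of functions that contains every coordinate of the
    Gauss map and is preserved by the Laplacian up to the factor [1 / q^2]. *)
Definition mode (eps1 : R) (x y : R -> R) (alpha c : R) (k0 k1 k2 k3 k4 : R)
  : scalar_field :=
  fun t s => k0 + k1 * cos (2 * t) + k2 * sin (2 * t)
             + k3 * boost_cos eps1 x y alpha c s
             + k4 * boost_sin eps1 x y alpha c s.

Lemma gauss_map_flat (a b : Rbar) (eps1 : R) (x y : R -> R) (alpha c : R)
  (p : plane) :
  profile a b eps1 x y -> flat_profile a b eps1 x y alpha c ->
  agree a b
    (fun t s => gauss_map (rotation_surface x y) (frame1 eps1 x y) frame2 t s p)
    (match p with
     | P12 => mode eps1 x y alpha c (eps1 * alpha / 2) 0 0 (- / 2) 0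
     | P34 => mode eps1 x y alpha c (- (eps1 * alpha / 2)) 0 0 (- / 2) 0
     | P13 => mode eps1 x y alpha c 0 0 (c / 2) 0 0
     | P24 => mode eps1 x y alpha c 0 0 (- (c / 2)) 0 0
     | P14 => mode eps1 x y alpha c 0 (- (c / 2)) 0 0 (- / 2)
     | P23 => mode eps1 x y alpha c 0 (- (c / 2)) 0 0 (/ 2)
     end).
Proof.
  intros hp hf t s hs.
  pose proof (radius_pos _ _ _ _ _ s hp hs) as qpos.
  pose proof (radius_sqr _ _ _ _ _ s hp hs) as q2.
  pose proof (profile_sign _ _ _ _ _ hp) as e2.
  unfold gauss_map, wedge, frame2.
  destruct p; simpl plane_axes; cbv iota beta; rewrite !push_coord_field;
    unfold push; rewrite !act_frame1, !partial_ct_component,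
      !partial_cs_component; unfold vec4, mode, boost_cos, boost_sin;
    rewrite ?(flat_Derive_x _ _ _ _ _ _ _ s hf hs),
      ?(flat_Derive_y _ _ _ _ _ _ _ s hf hs), ?cos_2a, ?sin_2a;
    set (q := radius eps1 x y s) in *.
  all: pose proof (sin_sqr t) as trig.
  all: assert (y2 : y s ^ 2 = x s ^ 2 + eps1 * q ^ 2) by lra.
  all: field [y2 trig e2]; lra.
Qed.

(** On the hyperbolic part, [C'' = (4 c^2 C - 2 eps1 c alpha S) / q^2], and
    the first-order term [alpha / q d_s] cancels the [alpha] contribution. *)
Lemma laplacian_mode (a b : Rbar) (eps1 : R) (x y : R -> R) (alpha c : R)
  (k0 k1 k2 k3 k4 : R) :
  profile a b eps1 x y -> flat_profile a b eps1 x y alpha c ->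
  agree a b
    (laplacian (rotation_surface x y) (frame1 eps1 x y) frame2
       (mode eps1 x y alpha c k0 k1 k2 k3 k4))
    (fun t s => - 4 / radius eps1 x y s ^ 2
                * mode eps1 x y alpha c 0 (eps1 * k1) (eps1 * k2)
                    (c ^ 2 * k3) (c ^ 2 * k4) t s).
Proof.
  intros hp hf t s hs.
  pose proof (radius_pos _ _ _ _ _ s hp hs) as qpos.
  pose proof (profile_sign _ _ _ _ _ hp) as e2.
  pose proof (flat_dradius _ _ _ _ _ _ _ hf s hs) as dq.
  destruct (is_derive_boost _ _ _ _ _ _ _ s hp hf hs) as [dC dS].
  rewrite (laplacian_flat _ _ _ _ _ _ _ _ hp hf t s hs).
  set (F := mode eps1 x y alpha c k0 k1 k2 k3 k4).
  assert (Ft : agree a b (partial ct F)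
    (fun u _ => - 2 * k1 * sin (2 * u) + 2 * k2 * cos (2 * u))).
  { intros u v hv; apply is_derive_unique; unfold F, mode;
      auto_derive; trivial; ring. }
  assert (Fs : agree a b (partial cs F)
    (fun _ v => 2 * eps1 * c / radius eps1 x y v
                * (k3 * boost_sin eps1 x y alpha c v
                   + k4 * boost_cos eps1 x y alpha c v))).
  { intros u v hv; apply is_derive_unique; unfold F, mode.
    destruct (is_derive_boost _ _ _ _ _ _ _ v hp hf hv) as [dC' dS'].
    auto_derive; [repeat split; eexists; eassumption|].
    change (fun r => boost_cos eps1 x y alpha c r) with (boost_cos eps1 x y alpha c).
    change (fun r => boost_sin eps1 x y alpha c r) with (boost_sin eps1 x y alpha c).
    rewrite (is_derive_unique _ _ _ dC'), (is_derive_unique _ _ _ dS'); ring. }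
  rewrite (partial_agree _ _ _ _ _ Ft t s hs),
    (partial_agree _ _ _ _ _ Fs t s hs), (Fs t s hs).
  replace (partial ct _ t s)
    with (- 4 * k1 * cos (2 * t) - 4 * k2 * sin (2 * t))
    by (symmetry; apply is_derive_unique; auto_derive; trivial; ring).
  match goal with |- context [partial cs ?H t s] => replace (partial cs H t s)
    with (2 * eps1 * c / radius eps1 x y s
          * (2 * eps1 * c / radius eps1 x y s
             * (k3 * boost_cos eps1 x y alpha c s
                + k4 * boost_sin eps1 x y alpha c s))
          - 2 * eps1 * c * alpha / radius eps1 x y s ^ 2
          * (k3 * boost_sin eps1 x y alpha c s
             + k4 * boost_cos eps1 x y alpha c s)) end.
  2:{ symmetry; apply is_derive_unique; auto_derive.
      - repeat split; solve [ eexists; eassumption | lra ].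
      - change (fun r => boost_cos eps1 x y alpha c r) with (boost_cos eps1 x y alpha c).
        change (fun r => boost_sin eps1 x y alpha c r) with (boost_sin eps1 x y alpha c).
        change (fun r => radius eps1 x y r) with (radius eps1 x y).
        rewrite (is_derive_unique _ _ _ dC), (is_derive_unique _ _ _ dS),
          (is_derive_unique _ _ _ dq); field; lra. }
  unfold mode; field [e2]; lra.
Qed.

Lemma laplacian_gauss_map_flat (a b : Rbar) (eps1 : R) (x y : R -> R)
  (alpha c : R) (p : plane) :
  profile a b eps1 x y -> flat_profile a b eps1 x y alpha c ->
  agree a b
    (laplacian (rotation_surface x y) (frame1 eps1 x y) frame2
      (fun t s => gauss_map (rotation_surface x y) (frame1 eps1 x y) frame2 t s p))
    (fun t s => - 4 / radius eps1 x y s ^ 2 *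
     (match p with
     | P12 | P34 => mode eps1 x y alpha c 0 0 0 (- (c ^ 2 / 2)) 0
     | P13 => mode eps1 x y alpha c 0 0 (eps1 * c / 2) 0 0
     | P24 => mode eps1 x y alpha c 0 0 (- (eps1 * c / 2)) 0 0
     | P14 => mode eps1 x y alpha c 0 (- (eps1 * c / 2)) 0 0 (- (c ^ 2 / 2))
     | P23 => mode eps1 x y alpha c 0 (- (eps1 * c / 2)) 0 0 (c ^ 2 / 2)
     end) t s).
Proof.
  intros hp hf t s hs.
  rewrite (laplacian_agree _ _ _ _ _ _ _ _ _ hp hf
    (gauss_map_flat _ _ _ _ _ _ _ p hp hf) t s hs).
  destruct p; rewrite (laplacian_mode _ _ _ _ _ _ _ _ _ _ _ _ hp hf t s hs);
    unfold mode, Rdiv; ring.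
Qed.

(** * Surfaces with pointwise 1-type Gauss map *)

(** Only the two lines [t = 0] and [t = pi / 4] are needed.  On [t = 0] the
    coordinate [P13] of the Gauss map vanishes while the [cos 2t] part of
    [P14 + P23] does not, so [f <> 0] and the constant vector has no
    [P13] coordinate.  On [t = pi / 4] this determines [f], and the combinations
    [P12 + P34] and [P23 - P14] isolate the two hyperbolic functions. *)
Lemma pointwise_1_type_boost_constant (a b : Rbar) (eps1 : R)
  (x y : R -> R) (alpha c : R) :
  Rbar_lt a b -> profile a b eps1 x y -> flat_profile a b eps1 x y alpha c ->
  c <> 0 ->
  pointwise_1_type a b (rotation_surface x y) (frame1 eps1 x y) frame2 ->
  exists kC kS : R, forall s, in_interval a b s ->
    alpha ^ 2 * boost_cos eps1 x y alpha c s = kC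
    /\ alpha ^ 2 * boost_sin eps1 x y alpha c s = kS.
Proof.
  intros hab hp hf c0 [f [C [_ hfC]]].
  pose proof (profile_sign _ _ _ _ _ hp) as e2.
  pose proof (sign_neq0 _ e2) as e0.
  pose proof (flat_const _ _ _ _ _ _ _ hf) as c2.
  assert (eqn : forall t s p, in_interval a b s -> _ = _)
    by (intros t s p hs; pose proof (hfC t s hs p) as h;
        rewrite (laplacian_gauss_map_flat _ _ _ _ _ _ _ p hp hf t s hs),
          (gauss_map_flat _ _ _ _ _ _ _ p hp hf t s hs) in h; exact h).
  assert (cos_q : cos (2 * (PI / 4)) = 0)
    by (replace (2 * (PI / 4)) with (PI / 2) by field; apply cos_PI2).
  assert (sin_q : sin (2 * (PI / 4)) = 1)
    by (replace (2 * (PI / 4)) with (PI / 2) by field; apply sin_PI2).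
  assert (cos_z : cos (2 * 0) = 1) by (rewrite Rmult_0_r; apply cos_0).
  assert (sin_z : sin (2 * 0) = 0) by (rewrite Rmult_0_r; apply sin_0).
  assert (q0 : forall s, in_interval a b s -> / radius eps1 x y s ^ 2 <> 0).
  { intros s hs; pose proof (radius_pos _ _ _ _ _ s hp hs).
    apply Rinv_neq_0_compat, pow_nonzero; lra. }
  assert (C13 : C P13 = 0).
  { destruct (in_interval_inhabited a b hab) as [s hs].
    pose proof (q0 s hs) as r0.
    pose proof (eqn 0 s P13 hs) as h13; pose proof (eqn 0 s P14 hs) as h14;
      pose proof (eqn 0 s P23 hs) as h23; unfold mode in h13, h14, h23.
    rewrite cos_z, sin_z in h13, h14, h23; unfold Rdiv in h13, h14, h23.
    set (r := / radius eps1 x y s ^ 2) in *.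
    assert (f0 : f 0 s <> 0).
    { intros z; rewrite z in h14, h23.
      assert (prod : eps1 * c * r = 0) by lra.
      apply Rmult_integral in prod; destruct prod as [prod|]; [|contradiction].
      apply Rmult_integral in prod; destruct prod; contradiction. }
    apply Rmult_eq_reg_l with (f 0 s); [lra|exact f0]. }
  exists (- eps1 * (C P12 + C P34)), (eps1 * (C P23 - C P14)); intros s hs.
  pose proof (q0 s hs) as r0.
  pose proof (eqn (PI / 4) s P13 hs) as h13;
    pose proof (eqn (PI / 4) s P12 hs) as h12;
    pose proof (eqn (PI / 4) s P34 hs) as h34;
    pose proof (eqn (PI / 4) s P14 hs) as h14;
    pose proof (eqn (PI / 4) s P23 hs) as h23;
    unfold mode in h13, h12, h34, h14, h23.
  rewrite cos_q, sin_q in *; unfold Rdiv in *; rewrite C13 in h13.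
  set (r := / radius eps1 x y s ^ 2) in *.
  assert (fq : f (PI * / 4) s = - 4 * eps1 * r)
    by (apply Rmult_eq_reg_r with (c * / 2); lra).
  rewrite fq in h12, h34, h14, h23.
  assert (a2 : alpha ^ 2 = c ^ 2 - eps1) by lra.
  rewrite a2; split; apply Rmult_eq_reg_l with r; lra.
Qed.

(** If [alpha <> 0], both hyperbolic functions are constant, so each of them,
    being a multiple of the derivative of the other, vanishes: impossible on
    the hyperbola. *)
Lemma flat_slope_zero_of_pointwise_1_type (a b : Rbar) (eps1 : R)
  (x y : R -> R) (alpha c : R) :
  Rbar_lt a b -> profile a b eps1 x y -> flat_profile a b eps1 x y alpha c ->
  c <> 0 ->
  pointwise_1_type a b (rotation_surface x y) (frame1 eps1 x y) frame2 ->
  alpha = 0.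
Proof.
  intros hab hp hf c0 h1.
  destruct (pointwise_1_type_boost_constant _ _ _ _ _ _ _ hab hp hf c0 h1)
    as [kC [kS hk]].
  destruct (in_interval_inhabited a b hab) as [s hs].
  pose proof (radius_pos _ _ _ _ _ s hp hs) as qpos.
  pose proof (sign_neq0 _ (profile_sign _ _ _ _ _ hp)) as e0.
  destruct (is_derive_boost _ _ _ _ _ _ _ s hp hf hs) as [dC dS].
  apply is_derive_unique in dC; apply is_derive_unique in dS.
  pose proof (derive_zero_of_constant a b _ _ s
    (fun v hv => proj1 (hk v hv)) hs) as zC.
  pose proof (derive_zero_of_constant a b _ _ s
    (fun v hv => proj2 (hk v hv)) hs) as zS.
  rewrite Derive_scal in zC, zS.
  change (alpha ^ 2 * Derive (boost_cos eps1 x y alpha c) s = 0) in zC.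
  change (alpha ^ 2 * Derive (boost_sin eps1 x y alpha c) s = 0) in zS.
  rewrite dC in zC; rewrite dS in zS.
  pose proof (boost_hyperbola _ _ _ _ _ _ _ s hp hf hs) as hyp.
  destruct (Req_dec alpha 0) as [a0|a0]; [exact a0|exfalso].
  assert (cancel : forall z,
    alpha ^ 2 * (2 * eps1 * c / radius eps1 x y s * z) = 0 -> z = 0).
  { intros z hz.
    replace z with (alpha ^ 2 * (2 * eps1 * c / radius eps1 x y s * z)
      * (radius eps1 x y s / (2 * alpha ^ 2 * eps1 * c)))
      by (field; repeat split; lra).
    rewrite hz; ring. }
  rewrite (cancel _ zC), (cancel _ zS) in hyp; lra.
Qed.

Lemma ex_diff_n_const (k : R) (n : nat) (t s : R) :
  ex_diff_n (fun _ _ => k) n t s.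
Proof.
  revert k; induction n as [|n IH]; intros k; simpl.
  - split; [apply continuity_2d_pt_const|trivial].
  - repeat split; try apply continuity_2d_pt_const; try apply ex_derive_const.
    + eapply ex_diff_n_ext_loc; [|apply (IH 0)].
      exists (mkposreal 1 Rlt_0_1); intros; symmetry; apply Derive_const.
    + eapply ex_diff_n_ext_loc; [|apply (IH 0)].
      exists (mkposreal 1 Rlt_0_1); intros; symmetry; apply Derive_const.
Qed.

(** For [c = 0] every coordinate of the Gauss map is harmonic. *)
Lemma pointwise_1_type_of_totally_geodesic (a b : Rbar) (eps1 : R)
  (x y : R -> R) (alpha : R) :
  profile a b eps1 x y -> flat_profile a b eps1 x y alpha 0 ->
  pointwise_1_type a b (rotation_surface x y) (frame1 eps1 x y) frame2.
Proof.
  intros hp hf; exists (fun _ _ => 0), (fun _ => 0); split.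
  - intros t s _ n; apply ex_diff_n_const.
  - intros t s hs p.
    rewrite (laplacian_gauss_map_flat _ _ _ _ _ _ _ p hp hf t s hs).
    destruct p; unfold mode, Rdiv; ring.
Qed.

Lemma radius_constant (a b : Rbar) (eps1 : R) (x y : R -> R) (c : R) :
  Rbar_lt a b -> profile a b eps1 x y -> flat_profile a b eps1 x y 0 c ->
  exists r : R, 0 < r /\ forall s, in_interval a b s -> radius eps1 x y s = r.
Proof.
  intros hab hp hf; destruct (in_interval_inhabited a b hab) as [s0 hs0].
  exists (radius eps1 x y s0); split.
  - now apply (radius_pos a b).
  - intros s hs; apply (constant_of_zero_derivative a b); trivial.
    exact (flat_dradius _ _ _ _ _ _ _ hf).
Qed.

(** For [alpha = 0], [c^2 = eps1] merges the two eigenvalues of the Laplacian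
    and the constant terms of the Gauss map drop out. *)
Lemma pointwise_1_type_of_constant_radius (a b : Rbar) (eps1 : R)
  (x y : R -> R) (c : R) :
  Rbar_lt a b -> profile a b eps1 x y -> flat_profile a b eps1 x y 0 c ->
  pointwise_1_type a b (rotation_surface x y) (frame1 eps1 x y) frame2.
Proof.
  intros hab hp hf.
  destruct (radius_constant _ _ _ _ _ _ hab hp hf) as [r [rpos hr]].
  pose proof (flat_const _ _ _ _ _ _ _ hf) as c2.
  exists (fun _ _ => - 4 * eps1 / r ^ 2), (fun _ => 0); split.
  - intros t s _ n; apply ex_diff_n_const.
  - intros t s hs p.
    rewrite (laplacian_gauss_map_flat _ _ _ _ _ _ _ p hp hf t s hs),
      (gauss_map_flat _ _ _ _ _ _ _ p hp hf t s hs), (hr s hs).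
    destruct p; unfold mode; rewrite ?c2; field; lra.
Qed.

(** * Integration of the profile curve *)

Definition exponential_profile (a b : Rbar) (x y : R -> R)
  (b0 mu1 mu2 d eps : R) : Prop :=
  forall s, in_interval a b s ->
    x s = 1 / 2 * eps
          * (mu2 * exp (- b0 * s + d) + mu1 * exp (- (- b0 * s + d)))
    /\ y s = 1 / 2 * eps
          * (mu2 * exp (- b0 * s + d) - mu1 * exp (- (- b0 * s + d))).

Lemma exponential_profile_of_constant_radius (a b : Rbar) (eps1 : R)
  (x y : R -> R) (c : R) :
  Rbar_lt a b -> profile a b eps1 x y -> flat_profile a b eps1 x y 0 c ->
  exists b0 mu1 mu2 : R, b0 <> 0 /\ mu1 * mu2 = - (1 / b0 ^ 2) /\
    exponential_profile a b x y b0 mu1 mu2 0 1.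
Proof.
  intros hab hp hf.
  destruct (radius_constant _ _ _ _ _ _ hab hp hf) as [r [rpos hr]].
  destruct (in_interval_inhabited a b hab) as [s0 hs0].
  pose proof (flat_const _ _ _ _ _ _ _ hf) as c2.
  pose proof (profile_sign _ _ _ _ _ hp) as e2.
  assert (e1 : eps1 = 1) by (assert (0 <= c ^ 2) by apply pow2_ge_0; nra).
  subst eps1.
  assert (c1 : c ^ 2 = 1) by lra.
  pose proof (sign_neq0 _ c1) as c0.
  assert (dxy : forall v, in_interval a b v ->
    is_derive x v (c * y v / r) /\ is_derive y v (c * x v / r)).
  { intros v hv; rewrite <- (hr v hv); split.
    - replace (c * y v) with (0 * x v + 1 * c * y v) by ring.
      now apply (flat_dx _ _ _ _ _ _ _ hf).
    - replace (c * x v) with (0 * y v + 1 * c * x v) by ring.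
      now apply (flat_dy _ _ _ _ _ _ _ hf). }
  (* x + y and x - y are eigenfunctions of the system x' = (c / r) y,
     y' = (c / r) x, so u and v below are first integrals. *)
  set (u := fun s => (x s + y s) * exp (- (c / r * s))).
  set (v := fun s => (x s - y s) * exp (c / r * s)).
  assert (cu : forall s, in_interval a b s -> u s = u s0).
  { intros s hs; apply (constant_of_zero_derivative a b); trivial.
    clear s hs; intros s hs; destruct (dxy s hs) as [dx dy].
    unfold u; auto_derive; [repeat split; eexists; eassumption|].
    change (fun r => x r) with x; change (fun r => y r) with y.
    rewrite (is_derive_unique _ _ _ dx), (is_derive_unique _ _ _ dy).
    field; lra. }
  assert (cv : forall s, in_interval a b s -> v s = v s0).
  { intros s hs; apply (constant_of_zero_derivative a b); trivial.
    clear s hs; intros s hs; destruct (dxy s hs) as [dx dy].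
    unfold v; auto_derive; [repeat split; eexists; eassumption|].
    change (fun r => x r) with x; change (fun r => y r) with y.
    rewrite (is_derive_unique _ _ _ dx), (is_derive_unique _ _ _ dy).
    field; lra. }
  assert (ee : forall z, exp z * exp (- z) = 1)
    by (intros z; rewrite <- exp_plus, Rplus_opp_r; apply exp_0).
  exists (- (c / r)), (v s0), (u s0); split; [|split].
  - apply Ropp_neq_0_compat; unfold Rdiv.
    apply Rmult_integral_contrapositive_currified;
      [exact c0|apply Rinv_neq_0_compat; lra].
  - transitivity (x s0 ^ 2 - y s0 ^ 2).
    + transitivity ((x s0 ^ 2 - y s0 ^ 2)
        * (exp (c / r * s0) * exp (- (c / r * s0)))).
      * unfold u, v; ring.
      * rewrite ee; ring.
    + rewrite (radius_sqr _ _ _ _ _ s0 hp hs0), (hr s0 hs0).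
      field [c1]; lra.
  - intros s hs; rewrite <- (cu s hs), <- (cv s hs); unfold u, v.
    replace (- - (c / r) * s + 0) with (c / r * s) by ring.
    split.
    + transitivity (/ 2 * ((x s + y s) + (x s - y s))
        * (exp (c / r * s) * exp (- (c / r * s)))); [rewrite ee|]; field; lra.
    + transitivity (/ 2 * ((x s + y s) - (x s - y s))
        * (exp (c / r * s) * exp (- (c / r * s)))); [rewrite ee|]; field; lra.
Qed.

Lemma flat_slope_zero_of_exponential_profile (a b : Rbar) (eps1 : R)
  (x y : R -> R) (alpha c b0 mu1 mu2 d eps : R) :
  Rbar_lt a b -> profile a b eps1 x y -> flat_profile a b eps1 x y alpha c ->
  eps ^ 2 = 1 -> exponential_profile a b x y b0 mu1 mu2 d eps -> alpha = 0.
Proof.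
  intros hab hp hf he hexp.
  destruct (in_interval_inhabited a b hab) as [s hs].
  pose proof (sign_neq0 _ (profile_sign _ _ _ _ _ hp)) as e0.
  assert (sq : forall v, in_interval a b v ->
    radius eps1 x y v ^ 2 = - (mu1 * mu2) / eps1).
  { intros v hv; apply Rmult_eq_reg_l with (- eps1); [|lra].
    rewrite <- (radius_sqr _ _ _ _ _ v hp hv).
    destruct (hexp v hv) as [-> ->].
    set (z := - b0 * v + d).
    transitivity (eps ^ 2 * (mu1 * mu2) * (exp z * exp (- z))); [field|].
    rewrite <- exp_plus, Rplus_opp_r, exp_0, he; field; exact e0. }
  rewrite <- (is_derive_unique _ _ _ (flat_dradius _ _ _ _ _ _ _ hf s hs)).
  apply (derive_zero_of_constant a b _ (radius eps1 x y s)); trivial.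
  intros v hv; apply (constant_of_constant_square a b _ _) with (2 := sq);
    trivial.
  intros w hw; eexists; exact (flat_dradius _ _ _ _ _ _ _ hf w hw).
Qed.

(** * Classification *)

Theorem theorem2 (a b : Rbar) (x y : R -> R) (eps1 : R)
  (hab : Rbar_lt a b)
  (hx : smooth_on a b x) (hy : smooth_on a b y)
  (heps1 : eps1 = 1 \/ eps1 = -1)
  (hunit : forall s : R, in_interval a b s ->
     (Derive x s) ^ 2 - (Derive y s) ^ 2 = 1)
  (hnondeg : forall s : R, in_interval a b s ->
     0 < eps1 * (y s ^ 2 - x s ^ 2))
  (hflat : flat a b (rotation_surface x y)) :
  pointwise_1_type a b (rotation_surface x y) (frame1 eps1 x y) frame2
  <->
  (totally_geodesic a b (rotation_surface x y) \/
   exists b0 mu1 mu2 d eps : R,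
     b0 <> 0 /\ (eps = 1 \/ eps = -1) /\ mu1 * mu2 = - (1 / b0 ^ 2) /\
     forall t s : R, in_interval a b s ->
       rotation_surface x y t s =
       vec4
         (1 / 2 * eps * (mu2 * exp (- b0 * s + d) + mu1 * exp (- (- b0 * s + d))) * cos t)
         (1 / 2 * eps * (mu2 * exp (- b0 * s + d) + mu1 * exp (- (- b0 * s + d))) * sin t)
         (1 / 2 * eps * (mu2 * exp (- b0 * s + d) - mu1 * exp (- (- b0 * s + d))) * cos t)
         (1 / 2 * eps * (mu2 * exp (- b0 * s + d) - mu1 * exp (- (- b0 * s + d))) * sin t)).
Proof.
  assert (hp : profile a b eps1 x y).
  { split; trivial.
    - intros s hs; exact (hx s hs 1%nat).
    - intros s hs; exact (hy s hs 1%nat).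
    - intros s hs; exact (hx s hs 2%nat).
    - intros s hs; exact (hy s hs 2%nat).
    - destruct heps1 as [-> | ->]; ring. }
  destruct (flat_profile_of_flat _ _ _ _ _ hab hp hflat) as [alpha [c hf]].
  rewrite (totally_geodesic_iff_flat _ _ _ _ _ _ _ hab hp hf).
  split.
  - intros h1.
    destruct (Req_dec c 0) as [c0|c0]; [now left|right].
    pose proof (flat_slope_zero_of_pointwise_1_type _ _ _ _ _ _ _ hab hp hf c0 h1)
      as a0; subst alpha.
    destruct (exponential_profile_of_constant_radius _ _ _ _ _ _ hab hp hf)
      as [b0 [mu1 [mu2 [hb0 [hmu hexp]]]]].
    exists b0, mu1, mu2, 0, 1; repeat split; trivial; [now left|].
    intros t s hs; destruct (hexp s hs) as [ex ey].
    unfold rotation_surface; now rewrite ex, ey.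
  - intros [c0 | [b0 [mu1 [mu2 [d [eps [hb0 [heps [hmu hsurf]]]]]]]]].
    + subst c; exact (pointwise_1_type_of_totally_geodesic _ _ _ _ _ _ hp hf).
    + assert (hexp : exponential_profile a b x y b0 mu1 mu2 d eps).
      { intros s hs; pose proof (hsurf 0 s hs) as e.
        unfold rotation_surface in e.
        rewrite cos_0, sin_0, !Rmult_1_r in e; split.
        - exact (f_equal (fun v : E42 => v X1) e).
        - exact (f_equal (fun v : E42 => v X3) e). }
      assert (a0 : alpha = 0).
      { apply (flat_slope_zero_of_exponential_profile a b eps1 x y alpha c
          b0 mu1 mu2 d eps); trivial.
        destruct heps as [-> | ->]; ring. }
      subst alpha.
      exact (pointwise_1_type_of_constant_radius _ _ _ _ _ _ hab hp hf).
Qed.
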